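(* Let $f_0,f_1,\phi$ be continuous real functions and consider the system $$x_{n+1}=f_0(u_n)+f_1(u_n)\,x_n,\qquad u_{n+1}=\phi(u_n).$$ Let $u_*$ be a stable attractor of $u_{n+1}=\phi(u_n)$ with $|f_1(u_* )|=1$, and suppose that the attracting fiber $\{u=u_*\}$ satisfies the fast enough convergence to the limit dynamics property. Consider initial conditions $(x_0,u_0)$ with $x_0\in\mathbb{R}$ and $u_0$ in the basin of attraction of $u=u_*$ for the recurrence $u_{n+1}=\phi(u_n)$. Then: (a) If $f_1(u_* )=1$ and $f_0(u_* )=0$, then there exists $\ell(x_0,u_0)\in\mathbb{R}$ such that $\lim_{n\to\infty}(x_n,u_n)=(\ell(x_0,u_0),u_* )$. (b) If $f_1(u_* )=-1$ and additionally $\phi$ is locally contractive at $u=u_*$, then there exists $\ell(x_0,u_0)\in\mathbb{R}$ such that $\lim_{n\to\infty}(x_{2n},u_{2n})=(\ell(x_0,u_0),u_* )$ and $\lim_{n\to\infty}(x_{2n+1},u_{2n+1})=(f_0(u_* )-\ell(x_0,u_0),u_* )$.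
   Context: The functions $f_0,f_1,\phi$ are defined and continuous on an open set $D\subseteq\mathbb{R}$ with $u_*\in D$. A stable attractor $u_*$ of $u_{n+1}=\phi(u_n)$ is a fixed point of $\phi$ that is Lyapunov stable and attracts all orbits starting sufficiently close to it. The basin of attraction of $u_*$ is the set of $u_0$ whose orbit under $\phi$ is well defined for all $n\ge0$ and converges to $u_*$. Fast enough convergence to the limit dynamics property (for $u_*$ a stable attractor of $u_{n+1}=\phi(u_n)$ and $|f_1(u_* )|=1$): there exists $\varepsilon>0$ such that if $\{u_n\}$ is a solution of $u_{n+1}=\phi(u_n)$ satisfying $|u_{n_0}-u_*|<\varepsilon$ for some $n_0$, then there exists a sequence $p_n$ such that $|u_n-u_*|\le p_n<\varepsilon$ for all $n\ge n_0$, $\lim_{n\to\infty}p_n=0$, and there exist two functions $V,W:[0,\varepsilon)\to[0,\infty)$ such that for all $u$ with $|u-u_*|<\varepsilon$: (H1) $|f_0(u)-f_0(u_* )|\le W(|u-u_*|)\le\overline{W}$ for some constant $\overline{W}\in\mathbb{R}$; (H2) $|f_1(u)-f_1(u_* )|\le V(|u-u_*|)\le\overline{V}$ for some constant $\overline{V}\in\mathbb{R}$; (H3) $V(\nu)$ and $W(\nu)$ are non-decreasing for $0\le\nu<\varepsilon$; (H4) $\sum_{j\ge n_0}W(p_j)<\infty$ and $\sum_{j\ge n_0}V(p_j)<\infty$. $\phi$ is locally contractive at the stable attractive fixed point $u_*$ if there is an open neighborhood $N$ of $u_*$ such that $|\phi(u)-u_*|<|u-u_*|$ for every $u\in N\setminus\{u_*\}$.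 *)

(* Defs.v *)
From HB Require Import structures.
From mathcomp Require Import all_boot all_order all_algebra.
From mathcomp Require Import all_classical all_reals all_analysis.

Set Implicit Arguments.
Unset Strict Implicit.
Unset Printing Implicit Defensive.

Import Order.TTheory GRing.Theory Num.Theory.
Import numFieldNormedType.Exports.

Local Open Scope classical_set_scope.
Local Open Scope ring_scope.

(* The functions f0, f1, phi live on an open set D; they are represented by
   total functions R -> R of which only the values on D are ever used. *)

(* Infinite solutions, i.e. orbits along which phi can always be applied. *)
Definition solution (R : realType) (D : set R) (phi : R -> R) (u : nat -> R) :=
  forall n, D (u n) /\ u n.+1 = phi (u n).

Definition orbit (R : realType) (phi : R -> R) (u0 : R) (n : nat) : R :=
  iter n phi u0.

Definition basin (R : realType) (D : set R) (phi : R -> R) (ustar : R) :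
    set R :=
  [set u0 | solution D phi (orbit phi u0) /\ orbit phi u0 @ \oo --> ustar].

Definition lyapunov_stable (R : realType) (D : set R) (phi : R -> R)
    (ustar : R) :=
  forall eps : R, 0 < eps -> exists2 delta : R, 0 < delta &
    forall u0, `|u0 - ustar| < delta ->
      solution D phi (orbit phi u0) /\
      forall n, `|orbit phi u0 n - ustar| < eps.

Definition stable_attractor (R : realType) (D : set R) (phi : R -> R)
    (ustar : R) :=
  [/\ D ustar, phi ustar = ustar, lyapunov_stable D phi ustar &
      exists2 delta : R, 0 < delta &
        forall u0, `|u0 - ustar| < delta -> basin D phi ustar u0].

Definition locally_contractive (R : realType) (D : set R) (phi : R -> R)
    (ustar : R) :=
  exists N : set R, [/\ open N, N ustar, N `<=` D &
    forall u, N u -> u != ustar -> `|phi u - ustar| < `|u - ustar|].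

(* (H1)/(H2) for f and G : [0, eps[ -> [0, +oo[; the total function G is only
   constrained on [0, eps[. *)
Definition modulus_at (R : realType) (D : set R) (f : R -> R) (ustar eps : R)
    (G : R -> R) :=
  (forall nu, nu \in `[0, eps[ -> 0 <= G nu) /\
  exists Gbar : R, forall u, D u -> `|u - ustar| < eps ->
    `|f u - f ustar| <= G `|u - ustar| <= Gbar.

Definition fast_enough_convergence (R : realType) (D : set R)
    (f0 f1 phi : R -> R) (ustar : R) :=
  exists2 eps : R, 0 < eps &
    forall (u : nat -> R) (n0 : nat),
      solution D phi u -> `|u n0 - ustar| < eps ->
      exists p : nat -> R,
        [/\ forall n, (n0 <= n)%N -> `|u n - ustar| <= p n < eps,
            p @ \oo --> 0 &
            exists V W : R -> R,
              [/\ modulus_at D f0 ustar eps W,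
                  modulus_at D f1 ustar eps V,
                  {in `[0, eps[ &, {homo V : s t / s <= t}},
                  {in `[0, eps[ &, {homo W : s t / s <= t}} &
                  (\sum_(n0 <= j <oo) (W (p j))%:E < +oo)%E /\
                  (\sum_(n0 <= j <oo) (V (p j))%:E < +oo)%E]].

(* The map (x_n, u_n) |-> (x_{n+1}, u_{n+1}). *)
Definition skew_map (R : realType) (f0 f1 phi : R -> R) (z : R * R) : R * R :=
  (f0 z.2 + f1 z.2 * z.1, phi z.2).

Definition skew_orbit (R : realType) (f0 f1 phi : R -> R) (x0 u0 : R)
    (n : nat) : R * R :=
  iter n (skew_map f0 f1 phi) (x0, u0).

(* Main.v *)
Require Import Defs.
From HB Require Import structures.
From mathcomp Require Import all_boot all_order all_algebra.
From mathcomp Require Import all_classical all_reals all_analysis.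
From mathcomp Require Import ring lra.

Import Order.TTheory GRing.Theory Num.Theory.
Import numFieldNormedType.Exports.

Local Open Scope classical_set_scope.
Local Open Scope ring_scope.

(** Along an orbit of phi that converges to ustar, the recurrence for x is a
summable perturbation of the limit recurrence x |-> f0 ustar + s * x, where
s = f1 ustar is 1 or -1.  In both cases this limit map has a fixed point c
(c = 0 when s = 1 and f0 ustar = 0, and c = f0 ustar / 2 when s = -1), so it is
an isometry fixing c, and the change of variable y_n = s^n (x_n - c) turns it
into the identity.  In these coordinates a step of the perturbed recurrence
satisfies |y_(n+1) - y_n| <= e_n (1 + |y_n|), where e_n dominates the errors
|f0 (u_n) - f0 ustar| and |f1 (u_n) - f1 ustar| and is summable because the
moduli W and V are summable along p.

A discrete Gronwall estimate ([discrete_gronwall]) then bounds y, so that its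
increments are absolutely summable and y converges ([cvgn_of_summable_steps],
[twisted_affine_cvgn]).  Undoing the change of variable gives x_n -> l when
s = 1, and when s = -1 the limits c + L of the even terms and c - L of the odd
ones, L being the limit of y; these add up to 2 c = f0 ustar. *)

(** Each step multiplies 1 + |x n| by at most 1 + c n <= exp (c n). *)
Lemma discrete_gronwall {R : realType} {x c : R^nat} :
  (forall n, `|x n.+1 - x n| <= c n * (1 + `|x n|)) ->
  forall n, 1 + `|x n| <= (1 + `|x 0%N|) * expR (series c n).
Proof.
move=> step; elim=> [|n IHn].
  by rewrite /series/= big_geq// expR0 mulr1.
rewrite seriesSr expRD mulrA.
apply: le_trans (ler_wpM2r (expR_ge0 _) IHn).
have x1 : 0 <= 1 + `|x n| by rewrite addr_ge0.
apply: le_trans (ler_wpM2l x1 (expR_ge1Dx (c n))).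
have := ler_normD (x n.+1 - x n) (x n); rewrite subrK.
by have := step n; lra.
Qed.

(** The exponential bound makes x bounded, hence the increments of x are
dominated by a multiple of the summable sequence c; x is then the sum of an
absolutely convergent telescoping series. *)
Lemma cvgn_of_summable_steps {R : realType} {x c : R^nat} :
  (forall n, 0 <= c n) -> cvgn (series c) ->
  (forall n, `|x n.+1 - x n| <= c n * (1 + `|x n|)) -> cvgn x.
Proof.
move=> c0 cc step.
pose M := (1 + `|x 0%N|) * expR (limn (series c)).
have xM n : 1 + `|x n| <= M.
  apply: le_trans (discrete_gronwall step n) _.
  rewrite ler_wpM2l ?addr_ge0// ler_expR nondecreasing_cvgn_le//.
  by apply/nondecreasing_seqP => m; rewrite seriesSr lerDl.
have : cvgn (series (telescope x)).
  apply/normed_cvg/(@series_le_cvg _ _ (M *: c)) => [n|n|n|].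
  - exact: normr_ge0.
  - by rewrite mulr_ge0// (le_trans _ (xM 0%N))// addr_ge0.
  - rewrite /telescope (le_trans (step n))//.
    by change (c n * (1 + `|x n|) <= M * c n); rewrite mulrC ler_wpM2r.
  - exact: is_cvg_seriesZ.
rewrite telescopeK => /(is_cvgD (is_cvg_cst (x 0%N))).
by rewrite (_ : _ + _ = x)//; apply/funext => n; rewrite fctE addrC subrK.
Qed.

(** The affine recurrence is close to the map x |-> al + s * x, an isometry
with fixed point c.  Multiplying x n - c by s ^+ n removes the rotation by s and
leaves a perturbation of the identity, to which [cvgn_of_summable_steps]
applies; it is applied from the index n0 on. *)
Lemma twisted_affine_cvgn {R : realType} {x a b : R^nat} {s al c : R}
    {n0 : nat} :
  `|s| = 1 -> al + s * c = c ->
  cvgn (series (fun k => `|a (k + n0)%N - al|)) ->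
  cvgn (series (fun k => `|b (k + n0)%N - s|)) ->
  (forall n, x n.+1 = a n + b n * x n) ->
  cvgn (fun n => s ^+ n * (x n - c)).
Proof.
move=> s1 fixc ca cb xE.
pose y n := s ^+ n * (x n - c).
suff /cvg_ex[l yl] : cvgn (fun k => y (k + n0)%N).
  by apply/cvg_ex; exists l; rewrite -/y -(cvg_shiftn n0).
pose A k := `|a (k + n0)%N - al|; pose B k := `|b (k + n0)%N - s|.
apply: (@cvgn_of_summable_steps _ _ (A + (1 + `|c|) *: B)).
- move=> n; change (0 <= A n + (1 + `|c|) * B n).
  by rewrite addr_ge0 ?mulr_ge0 ?addr_ge0 /A /B.
- by apply: is_cvg_seriesD ca _; apply: is_cvg_seriesZ cb.
move=> k; rewrite addSn; set n := (k + n0)%N.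
have sn m : `|s ^+ m| = 1 by rewrite normrX s1 expr1n.
have ss : s * s = 1 by rewrite -expr2 -real_normK ?num_real// s1 expr1n.
(* The unperturbed map contributes nothing to the increment of y, because
   s * s = 1 and c is its fixed point. *)
have -> : y n.+1 - y n =
    s ^+ n.+1 * (a n - al + (b n - s) * c + (b n - s) * (x n - c)).
  have alE : al = c - s * c by rewrite -{1}fixc; ring.
  by rewrite /y xE exprS alE; ring: ss.
rewrite normrM sn mul1r.
have -> : `|y n| = `|x n - c| by rewrite normrM sn mul1r.
change (`|a n - al + (b n - s) * c + (b n - s) * (x n - c)| <=
 (`|a n - al| + (1 + `|c|) * `|b n - s|) * (1 + `|x n - c|)).
have := ler_normD (a n - al + (b n - s) * c) ((b n - s) * (x n - c)).
have := ler_normD (a n - al) ((b n - s) * c); rewrite !normrM.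
set p := `|a n - al|; set q := `|b n - s|; set z := `|x n - c|.
have p0 : 0 <= p := normr_ge0 _; have q0 : 0 <= q := normr_ge0 _.
have z0 : 0 <= z := normr_ge0 _.
have := mulr_ge0 p0 z0; have := mulr_ge0 (mulr_ge0 q0 (normr_ge0 c)) z0.
lra.
Qed.

(** Monotonicity of G replaces the actual distance to ustar by its majorant p,
along which G is summable. *)
Lemma modulus_summable {R : realType} {D : set R} {f G : R -> R}
    {ustar eps : R} {u p : R^nat} {n0 : nat} :
  modulus_at D f ustar eps G ->
  {in `[0, eps[ &, {homo G : s t / s <= t}} ->
  (forall n, D (u n)) ->
  (forall n, (n0 <= n)%N -> `|u n - ustar| <= p n < eps) ->
  (\sum_(n0 <= j <oo) (G (p j))%:E < +oo)%E ->
  cvgn (series (fun k => `|f (u (k + n0)%N) - f ustar|)).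
Proof.
move=> [_ [Gbar fG]] Gmono Du up Gp.
apply: nnseries_is_cvg => //.
rewrite (@nneseries_addn _ (fun i => `|f (u i) - f ustar|%:E)); last first.
  by move=> i; rewrite lee_fin.
have G_ge i : (n0 <= i)%N -> `|f (u i) - f ustar| <= G (p i).
  move=> n0i; have /andP[upi pi] := up i n0i.
  have ui := le_lt_trans upi pi.
  have /andP[fui _] := fG _ (Du i) ui.
  rewrite (le_trans fui)// Gmono// in_itv/= ?normr_ge0//=.
  by rewrite pi andbT (le_trans _ upi).
apply: le_lt_trans Gp; apply: lee_lim.
- by apply: is_cvg_nneseries => i _ _; rewrite lee_fin.
- apply: is_cvg_nneseries => i n0i _.
  by rewrite lee_fin (le_trans _ (G_ge i n0i)).
- apply: nearW => n; rewrite !big_seq; apply: lee_sum => i.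
  rewrite mem_index_iota => /andP[n0i _].
  by rewrite lee_fin G_ge.
Qed.

Lemma skew_orbit2 (R : realType) (f0 f1 phi : R -> R) (x0 u0 : R) n :
  (skew_orbit f0 f1 phi x0 u0 n).2 = Defs.orbit phi u0 n.
Proof. by elim: n => //= n ->. Qed.

(** After some index n0 the orbit of u0 is within the radius eps in which the
moduli control f0 and f1, which provides the summable errors required by
[twisted_affine_cvgn]. *)
Lemma skew_orbit_twisted_cvgn {R : realType} {D : set R}
    {f0 f1 phi : R -> R} {ustar c : R} (x0 : R) {u0 : R} :
  `|f1 ustar| = 1 -> f0 ustar + f1 ustar * c = c ->
  fast_enough_convergence D f0 f1 phi ustar -> basin D phi ustar u0 ->
  cvgn (fun n => f1 ustar ^+ n * ((skew_orbit f0 f1 phi x0 u0 n).1 - c)).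
Proof.
move=> f1s fixc [eps eps0 fast] [sol /cvgrPdist_lt/(_ _ eps0)[n0 _ near]].
have n0_close : `|Defs.orbit phi u0 n0 - ustar| < eps.
  by rewrite distrC; exact: near (leqnn n0).
have [p [up _ [V [W [modW modV Vmono Wmono [sumW sumV]]]]]] :=
  fast _ _ sol n0_close.
have Du n : D (Defs.orbit phi u0 n) by case: (sol n).
have sum0 := modulus_summable modW Wmono Du up sumW.
have sum1 := modulus_summable modV Vmono Du up sumV.
apply: (@twisted_affine_cvgn _ _ (fun n => f0 (Defs.orbit phi u0 n))
  (fun n => f1 (Defs.orbit phi u0 n)) _ _ _ n0 f1s fixc) => // n.
by rewrite /= skew_orbit2.
Qed.

Lemma skew_orbit_subseq_cvg {R : realType} {D : set R}
    {f0 f1 phi : R -> R} {ustar x0 u0 l : R} {k : nat -> nat} :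
  basin D phi ustar u0 -> k n @[n --> \oo] --> \oo ->
  (skew_orbit f0 f1 phi x0 u0 (k n)).1 @[n --> \oo] --> l ->
  skew_orbit f0 f1 phi x0 u0 (k n) @[n --> \oo] --> (l, ustar).
Proof.
move=> [_ uu] koo xl.
under eq_fun do rewrite [skew_orbit _ _ _ _ _ _]surjective_pairing skew_orbit2.
exact: (cvg_pair xl (cvg_comp _ _ koo uu)).
Qed.

Theorem theorem6 (R : realType) (D : set R) (f0 f1 phi : R -> R) (ustar : R)
  (openD : open D)
  (f0_cont : {within D, continuous f0})
  (f1_cont : {within D, continuous f1})
  (phi_cont : {within D, continuous phi})
  (ustar_attr : stable_attractor D phi ustar)
  (f1_ustar : `|f1 ustar| = 1)
  (fast : fast_enough_convergence D f0 f1 phi ustar)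
  (x0 u0 : R) (u0_basin : basin D phi ustar u0) :
  (f1 ustar = 1 -> f0 ustar = 0 ->
    exists l : R,
      skew_orbit f0 f1 phi x0 u0 n @[n --> \oo] --> (l, ustar)) /\
  (f1 ustar = -1 -> locally_contractive D phi ustar ->
    exists l : R,
      skew_orbit f0 f1 phi x0 u0 n.*2 @[n --> \oo] --> (l, ustar) /\
      skew_orbit f0 f1 phi x0 u0 n.*2.+1 @[n --> \oo]
        --> (f0 ustar - l, ustar)).
Proof.
split=> [f1E f0E|f1E _].
  have fix0 : f0 ustar + f1 ustar * 0 = 0 by rewrite f0E mulr0 addr0.
  have /cvg_ex[l xl] := skew_orbit_twisted_cvgn x0 f1_ustar fix0 fast u0_basin.
  exists l; apply: (skew_orbit_subseq_cvg u0_basin cvg_id).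
  move: xl; rewrite f1E.
  by under eq_fun do rewrite expr1n mul1r subr0.
(* The reflection x |-> f0 ustar - x fixes its midpoint. *)
pose c := f0 ustar / 2.
have fixc : f0 ustar + f1 ustar * c = c by rewrite f1E /c; lra.
have /cvg_ex[l yl] := skew_orbit_twisted_cvgn x0 f1_ustar fixc fast u0_basin.
have double_oo : n.*2 @[n --> \oo] --> \oo.
  by under eq_fun do rewrite -muln2; exact: cvg_mulnr.
have double1_oo : n.*2.+1 @[n --> \oo] --> \oo.
  by under eq_fun do rewrite -addn1; exact: cvg_comp double_oo (cvg_addnr 1).
exists (c + l).
rewrite (_ : f0 ustar - (c + l) = c - l); last by rewrite /c; field.
split; apply: (skew_orbit_subseq_cvg u0_basin) => //.
  have -> : (fun n => (skew_orbit f0 f1 phi x0 u0 n.*2).1) =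
      (fun n => c + f1 ustar ^+ n.*2 *
                    ((skew_orbit f0 f1 phi x0 u0 n.*2).1 - c)).
    by apply/funext => n; rewrite f1E -mul2n exprM sqrrN !expr1n mul1r subrKC.
  exact: cvgD (cvg_cst c) (cvg_comp _ _ double_oo yl).
have -> : (fun n => (skew_orbit f0 f1 phi x0 u0 n.*2.+1).1) =
    (fun n => c - f1 ustar ^+ n.*2.+1 *
                  ((skew_orbit f0 f1 phi x0 u0 n.*2.+1).1 - c)).
  apply/funext => n; rewrite f1E exprS -mul2n exprM sqrrN !expr1n mulr1.
  by rewrite mulN1r opprK subrKC.
exact: cvgB (cvg_cst c) (cvg_comp _ _ double1_oo yl).
Qed.
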